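(* Let $\mathbb{K}$ be an algebraically closed field of characteristic not $2$ and $d\ge 0$ an integer. Each parameter array of diameter $d$ over $\mathbb{K}$ belonging to one of Terwilliger's seven $q$-families (listed in the context: $q$-Racah, $q$-Hahn, dual $q$-Hahn, $q$-Krawtchouk, dual $q$-Krawtchouk, quantum $q$-Krawtchouk, affine $q$-Krawtchouk) can be transformed by an affine transformation $$\theta_i\mapsto t\theta_i+c,\quad \theta_i^*\mapsto t^*\theta_i^*+c^*,\quad \varphi_i\mapsto tt^*\varphi_i,\quad \phi_i\mapsto tt^*\phi_i\qquad(c,c^*,t,t^*\in\mathbb{K},\ t,t^*\ne0)$$ to the following form, according to its family ($0\le i\le d$ for $\theta_i,\theta_i^*$; $1\le i\le d$ for $\varphi_i,\phi_i$): - $q$-Racah: $\theta_i=q^{-i}+s\,q^{i+1}$, $\theta_i^*=q^{-i}+s^*q^{i+1}$, $\varphi_i=q^{1-2i}(1-q^i)(1-q^{i-d-1})(1-rq^i)(r-ss^*q^{d+1+i})/r$, $\phi_i=q^{1-2i}(1-q^i)(1-q^{i-d-1})(r-s^*q^i)(sq^{d+1}-rq^i)/r$. - $q$-Hahn: $\theta_i=q^{-i}$, $\theta_i^*=q^{-i}+s^*q^{i+1}$, $\varphi_i=q^{1-2i}(1-q^i)(1-q^{i-d-1})(1-rq^i)$, $\phi_i=-q^{1-i}(1-q^i)(1-q^{i-d-1})(r-s^*q^i)$. - Dual $q$-Hahn: $\theta_i=q^{-i}+sq^{i+1}$, $\theta_i^*=q^{-i}$, $\varphi_i=q^{1-2i}(1-q^i)(1-q^{i-d-1})(1-rq^i)$,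 $\phi_i=q^{d+2-2i}(1-q^i)(1-q^{i-d-1})(s-rq^{i-d-1})$. - $q$-Krawtchouk: $\theta_i=q^{-i}$, $\theta_i^*=q^{-i}+s^*q^{i+1}$, $\varphi_i=q^{1-2i}(1-q^i)(1-q^{i-d-1})$, $\phi_i=s^*q(1-q^i)(1-q^{i-d-1})$. - Dual $q$-Krawtchouk: $\theta_i=q^{-i}+sq^{i+1}$, $\theta_i^*=q^{-i}$, $\varphi_i=q^{1-2i}(1-q^i)(1-q^{i-d-1})$, $\phi_i=sq^{d+2-2i}(1-q^i)(1-q^{i-d-1})$. - Quantum $q$-Krawtchouk: $\theta_i=q^{i+1}$, $\theta_i^*=q^{-i}$, $\varphi_i=-rq^{1-i}(1-q^i)(1-q^{i-d-1})$, $\phi_i=q^{d+2-2i}(1-q^i)(1-q^{i-d-1})(1-rq^{i-d-1})$. - Affine $q$-Krawtchouk: $\theta_i=q^{-i}$, $\theta_i^*=q^{-i}$, $\varphi_i=q^{1-2i}(1-q^i)(1-q^{i-d-1})(1-rq^i)$, $\phi_i=-rq^{1-i}(1-q^i)(1-q^{i-d-1})$. In each case, $q,s,s^*,r$ (those that occur) are nonzero scalars in $\mathbb{K}$ such that $\theta_i\ne\theta_j$, $\theta_i^*\ne\theta_j^*$ for $0\le i<j\le d$, and $\varphi_i\ne0$, $\phi_i\ne0$ for $1\le i\le d$.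
   Context: A parameter array over $\mathbb{K}$ of diameter $d$ is a sequence $(\theta_0,\ldots,\theta_d;\theta_0^*,\ldots,\theta_d^*;\varphi_1,\ldots,\varphi_d;\phi_1,\ldots,\phi_d)$ of scalars in $\mathbb{K}$ such that: PA1. $\theta_i\neq\theta_j$, $\theta_i^*\ne\theta_j^*$ for $i\neq j$, $0\le i,j\le d$. PA2. $\varphi_i\ne0$, $\phi_i\ne0$ for $1\le i\le d$. PA3. $\varphi_i=\phi_1\sum_{j=0}^{i-1}\frac{\theta_j-\theta_{d-j}}{\theta_0-\theta_d}+(\theta_i^*-\theta_0^* )(\theta_{i-1}-\theta_d)$ for $1\le i\le d$. PA4. $\phi_i=\varphi_1\sum_{j=0}^{i-1}\frac{\theta_j-\theta_{d-j}}{\theta_0-\theta_d}+(\theta_i^*-\theta_0^* )(\theta_{d-i+1}-\theta_0)$ for $1\le i\le d$. PA5. $\frac{\theta_{i-2}-\theta_{i+1}}{\theta_{i-1}-\theta_i}$ and $\frac{\theta^*_{i-2}-\theta^*_{i+1}}{\theta^*_{i-1}-\theta^*_i}$ are equal and independent of $i$ for $2\le i\le d-1$. Terwilliger's $q$-families: parameter arrays of the following forms, where $\theta_0,\theta_0^*\in\mathbb{K}$ are arbitrary and the other occurring parameters $h,h^*,q,s,s^*,r,r_1,r_2\in\mathbb{K}$ are nonzero. Write $P_i=(1-q^i)(1-q^{i-d-1})$. - $q$-Racah: $\theta_i=\theta_0+h(1-q^i)(1-sq^{i+1})q^{-i}$, $\theta_i^*=\theta_0^*+h^*(1-q^i)(1-s^*q^{i+1})q^{-i}$,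 $\varphi_i=hh^*q^{1-2i}P_i(1-r_1q^i)(1-r_2q^i)$, $\phi_i=hh^*q^{1-2i}P_i(r_1-s^*q^i)(r_2-s^*q^i)/s^*$, with $r_1r_2=ss^*q^{d+1}$. - $q$-Hahn: $\theta_i=\theta_0+h(1-q^i)q^{-i}$, $\theta_i^*=\theta_0^*+h^*(1-q^i)(1-s^*q^{i+1})q^{-i}$, $\varphi_i=hh^*q^{1-2i}P_i(1-rq^i)$, $\phi_i=-hh^*q^{1-i}P_i(r-s^*q^i)$. - Dual $q$-Hahn: $\theta_i=\theta_0+h(1-q^i)(1-sq^{i+1})q^{-i}$, $\theta_i^*=\theta_0^*+h^*(1-q^i)q^{-i}$, $\varphi_i=hh^*q^{1-2i}P_i(1-rq^i)$, $\phi_i=hh^*q^{d+2-2i}P_i(s-rq^{i-d-1})$. - $q$-Krawtchouk: $\theta_i=\theta_0+h(1-q^i)q^{-i}$, $\theta_i^*=\theta_0^*+h^*(1-q^i)(1-s^*q^{i+1})q^{-i}$, $\varphi_i=hh^*q^{1-2i}P_i$, $\phi_i=hh^*s^*qP_i$. - Dual $q$-Krawtchouk: $\theta_i=\theta_0+h(1-q^i)(1-sq^{i+1})q^{-i}$, $\theta_i^*=\theta_0^*+h^*(1-q^i)q^{-i}$, $\varphi_i=hh^*q^{1-2i}P_i$, $\phi_i=hh^*sq^{d+2-2i}P_i$. - Quantum $q$-Krawtchouk: $\theta_i=\theta_0-sq(1-q^i)$, $\theta_i^*=\theta_0^*+h^*(1-q^i)q^{-i}$, $\varphi_i=-rh^*q^{1-i}P_i$,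 $\phi_i=h^*q^{d+2-2i}P_i(s-rq^{i-d-1})$. - Affine $q$-Krawtchouk: $\theta_i=\theta_0+h(1-q^i)q^{-i}$, $\theta_i^*=\theta_0^*+h^*(1-q^i)q^{-i}$, $\varphi_i=hh^*q^{1-2i}P_i(1-rq^i)$, $\phi_i=-hh^*rq^{1-i}P_i$. *)

(* Defs.v *)
From HB Require Import structures.
From mathcomp Require Import all_boot all_order all_algebra.

Set Implicit Arguments.
Unset Strict Implicit.
Unset Printing Implicit Defensive.

Import GRing.Theory.
Local Open Scope ring_scope.

(* The data (theta_i; theta*_i; varphi_i; phi_i) as functions on nat.  For an
   array of diameter d, only the values of theta, thetas at 0 <= i <= d and of
   varphi, phi at 1 <= i <= d are meaningful; see [agree]. *)
Record scalar_array (K : Type) := ScalarArray {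
  theta : nat -> K;
  thetas : nat -> K;
  varphi : nat -> K;
  phi : nat -> K
}.

Definition agree (K : Type) (d : nat) (p p' : scalar_array K) : Prop :=
  (forall i, (i <= d)%N -> theta p i = theta p' i /\ thetas p i = thetas p' i)
  /\
  (forall i, (1 <= i <= d)%N -> varphi p i = varphi p' i /\ phi p i = phi p' i).

Section ParameterArrays.

Variables (K : fieldType) (d : nat).
Implicit Type p : scalar_array K.

Definition PA1 p : Prop :=
  forall i j, (i <= d)%N -> (j <= d)%N -> i != j ->
    theta p i != theta p j /\ thetas p i != thetas p j.

Definition PA2 p : Prop :=
  forall i, (1 <= i <= d)%N -> varphi p i != 0 /\ phi p i != 0.

Definition PA3 p : Prop :=
  forall i, (1 <= i <= d)%N ->
    varphi p i =
      phi p 1%N * (\sum_(0 <= j < i)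
                     (theta p j - theta p (d - j)%N) / (theta p 0%N - theta p d))
      + (thetas p i - thetas p 0%N) * (theta p (i - 1)%N - theta p d).

Definition PA4 p : Prop :=
  forall i, (1 <= i <= d)%N ->
    phi p i =
      varphi p 1%N * (\sum_(0 <= j < i)
                     (theta p j - theta p (d - j)%N) / (theta p 0%N - theta p d))
      + (thetas p i - thetas p 0%N) * (theta p (d - i + 1)%N - theta p 0%N).

Definition PA5 p : Prop :=
  exists b : K, forall i, (2 <= i <= d - 1)%N ->
    (theta p (i - 2)%N - theta p (i + 1)%N) / (theta p (i - 1)%N - theta p i) = b
    /\
    (thetas p (i - 2)%N - thetas p (i + 1)%N)
      / (thetas p (i - 1)%N - thetas p i) = b.

Definition parameter_array p : Prop :=
  [/\ PA1 p, PA2 p, PA3 p, PA4 p & PA5 p].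

Definition affine_transform (t c ts cs : K) p : scalar_array K :=
  ScalarArray (fun i => t * theta p i + c)
              (fun i => ts * thetas p i + cs)
              (fun i => t * ts * varphi p i)
              (fun i => t * ts * phi p i).

End ParameterArrays.

Inductive q_family : Set :=
  | qRacah
  | qHahn
  | dual_qHahn
  | qKrawtchouk
  | dual_qKrawtchouk
  | quantum_qKrawtchouk
  | affine_qKrawtchouk.

Section Families.

Variables (K : fieldType) (d : nat).
Implicit Types (p : scalar_array K) (th ths h hs q s ss r : K).

Definition Pfac q (i : nat) : K :=
  (1 - q ^+ i) * (1 - q ^ (i%:Z - d%:Z - 1)).

(* The suffix s (as in ths0, hs, ss) stands for a star. *)

Definition qRacah_array th0 ths0 h hs q s ss r1 r2 : scalar_array K :=
  ScalarArray
    (fun i => th0 + h * (1 - q ^+ i) * (1 - s * q ^+ (i + 1)) * q ^- i)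
    (fun i => ths0 + hs * (1 - q ^+ i) * (1 - ss * q ^+ (i + 1)) * q ^- i)
    (fun i => h * hs * q ^ (1 - 2 * i%:Z) * Pfac q i
                * (1 - r1 * q ^+ i) * (1 - r2 * q ^+ i))
    (fun i => h * hs * q ^ (1 - 2 * i%:Z) * Pfac q i
                * (r1 - ss * q ^+ i) * (r2 - ss * q ^+ i) / ss).

Definition qHahn_array th0 ths0 h hs q ss r : scalar_array K :=
  ScalarArray
    (fun i => th0 + h * (1 - q ^+ i) * q ^- i)
    (fun i => ths0 + hs * (1 - q ^+ i) * (1 - ss * q ^+ (i + 1)) * q ^- i)
    (fun i => h * hs * q ^ (1 - 2 * i%:Z) * Pfac q i * (1 - r * q ^+ i))
    (fun i => - (h * hs * q ^ (1 - i%:Z) * Pfac q i * (r - ss * q ^+ i))).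

Definition dual_qHahn_array th0 ths0 h hs q s r : scalar_array K :=
  ScalarArray
    (fun i => th0 + h * (1 - q ^+ i) * (1 - s * q ^+ (i + 1)) * q ^- i)
    (fun i => ths0 + hs * (1 - q ^+ i) * q ^- i)
    (fun i => h * hs * q ^ (1 - 2 * i%:Z) * Pfac q i * (1 - r * q ^+ i))
    (fun i => h * hs * q ^ (d%:Z + 2 - 2 * i%:Z) * Pfac q i
                * (s - r * q ^ (i%:Z - d%:Z - 1))).

Definition qKrawtchouk_array th0 ths0 h hs q ss : scalar_array K :=
  ScalarArray
    (fun i => th0 + h * (1 - q ^+ i) * q ^- i)
    (fun i => ths0 + hs * (1 - q ^+ i) * (1 - ss * q ^+ (i + 1)) * q ^- i)
    (fun i => h * hs * q ^ (1 - 2 * i%:Z) * Pfac q i)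
    (fun i => h * hs * ss * q * Pfac q i).

Definition dual_qKrawtchouk_array th0 ths0 h hs q s : scalar_array K :=
  ScalarArray
    (fun i => th0 + h * (1 - q ^+ i) * (1 - s * q ^+ (i + 1)) * q ^- i)
    (fun i => ths0 + hs * (1 - q ^+ i) * q ^- i)
    (fun i => h * hs * q ^ (1 - 2 * i%:Z) * Pfac q i)
    (fun i => h * hs * s * q ^ (d%:Z + 2 - 2 * i%:Z) * Pfac q i).

Definition quantum_qKrawtchouk_array th0 ths0 hs q s r : scalar_array K :=
  ScalarArray
    (fun i => th0 - s * q * (1 - q ^+ i))
    (fun i => ths0 + hs * (1 - q ^+ i) * q ^- i)
    (fun i => - (r * hs * q ^ (1 - i%:Z) * Pfac q i))
    (fun i => hs * q ^ (d%:Z + 2 - 2 * i%:Z) * Pfac q i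
                * (s - r * q ^ (i%:Z - d%:Z - 1))).

Definition affine_qKrawtchouk_array th0 ths0 h hs q r : scalar_array K :=
  ScalarArray
    (fun i => th0 + h * (1 - q ^+ i) * q ^- i)
    (fun i => ths0 + hs * (1 - q ^+ i) * q ^- i)
    (fun i => h * hs * q ^ (1 - 2 * i%:Z) * Pfac q i * (1 - r * q ^+ i))
    (fun i => - (h * hs * r * q ^ (1 - i%:Z) * Pfac q i)).

Definition in_q_family (f : q_family) p : Prop :=
  match f with
  | qRacah =>
      exists th0 ths0 h hs q s ss r1 r2,
        [/\ 0 \notin [:: h; hs; q; s; ss; r1; r2],
            r1 * r2 = s * ss * q ^+ (d + 1)
          & agree d p (qRacah_array th0 ths0 h hs q s ss r1 r2)]
  | qHahn =>
      exists th0 ths0 h hs q ss r,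
        0 \notin [:: h; hs; q; ss; r]
        /\ agree d p (qHahn_array th0 ths0 h hs q ss r)
  | dual_qHahn =>
      exists th0 ths0 h hs q s r,
        0 \notin [:: h; hs; q; s; r]
        /\ agree d p (dual_qHahn_array th0 ths0 h hs q s r)
  | qKrawtchouk =>
      exists th0 ths0 h hs q ss,
        0 \notin [:: h; hs; q; ss]
        /\ agree d p (qKrawtchouk_array th0 ths0 h hs q ss)
  | dual_qKrawtchouk =>
      exists th0 ths0 h hs q s,
        0 \notin [:: h; hs; q; s]
        /\ agree d p (dual_qKrawtchouk_array th0 ths0 h hs q s)
  | quantum_qKrawtchouk =>
      exists th0 ths0 hs q s r,
        0 \notin [:: hs; q; s; r]
        /\ agree d p (quantum_qKrawtchouk_array th0 ths0 hs q s r)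
  | affine_qKrawtchouk =>
      exists th0 ths0 h hs q r,
        0 \notin [:: h; hs; q; r]
        /\ agree d p (affine_qKrawtchouk_array th0 ths0 h hs q r)
  end.

Definition qRacah_normal q s ss r : scalar_array K :=
  ScalarArray
    (fun i => q ^- i + s * q ^+ (i + 1))
    (fun i => q ^- i + ss * q ^+ (i + 1))
    (fun i => q ^ (1 - 2 * i%:Z) * (1 - q ^+ i) * (1 - q ^ (i%:Z - d%:Z - 1))
                * (1 - r * q ^+ i) * (r - s * ss * q ^+ (d + 1 + i)) / r)
    (fun i => q ^ (1 - 2 * i%:Z) * (1 - q ^+ i) * (1 - q ^ (i%:Z - d%:Z - 1))
                * (r - ss * q ^+ i) * (s * q ^+ (d + 1) - r * q ^+ i) / r).

Definition qHahn_normal q ss r : scalar_array K :=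
  ScalarArray
    (fun i => q ^- i)
    (fun i => q ^- i + ss * q ^+ (i + 1))
    (fun i => q ^ (1 - 2 * i%:Z) * (1 - q ^+ i) * (1 - q ^ (i%:Z - d%:Z - 1))
                * (1 - r * q ^+ i))
    (fun i => - (q ^ (1 - i%:Z) * (1 - q ^+ i) * (1 - q ^ (i%:Z - d%:Z - 1))
                   * (r - ss * q ^+ i))).

Definition dual_qHahn_normal q s r : scalar_array K :=
  ScalarArray
    (fun i => q ^- i + s * q ^+ (i + 1))
    (fun i => q ^- i)
    (fun i => q ^ (1 - 2 * i%:Z) * (1 - q ^+ i) * (1 - q ^ (i%:Z - d%:Z - 1))
                * (1 - r * q ^+ i))
    (fun i => q ^ (d%:Z + 2 - 2 * i%:Z)
                * (1 - q ^+ i) * (1 - q ^ (i%:Z - d%:Z - 1))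
                * (s - r * q ^ (i%:Z - d%:Z - 1))).

Definition qKrawtchouk_normal q ss : scalar_array K :=
  ScalarArray
    (fun i => q ^- i)
    (fun i => q ^- i + ss * q ^+ (i + 1))
    (fun i => q ^ (1 - 2 * i%:Z) * (1 - q ^+ i) * (1 - q ^ (i%:Z - d%:Z - 1)))
    (fun i => ss * q * (1 - q ^+ i) * (1 - q ^ (i%:Z - d%:Z - 1))).

Definition dual_qKrawtchouk_normal q s : scalar_array K :=
  ScalarArray
    (fun i => q ^- i + s * q ^+ (i + 1))
    (fun i => q ^- i)
    (fun i => q ^ (1 - 2 * i%:Z) * (1 - q ^+ i) * (1 - q ^ (i%:Z - d%:Z - 1)))
    (fun i => s * q ^ (d%:Z + 2 - 2 * i%:Z)
                * (1 - q ^+ i) * (1 - q ^ (i%:Z - d%:Z - 1))).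

Definition quantum_qKrawtchouk_normal q r : scalar_array K :=
  ScalarArray
    (fun i => q ^+ (i + 1))
    (fun i => q ^- i)
    (fun i => - (r * q ^ (1 - i%:Z)
                   * (1 - q ^+ i) * (1 - q ^ (i%:Z - d%:Z - 1))))
    (fun i => q ^ (d%:Z + 2 - 2 * i%:Z)
                * (1 - q ^+ i) * (1 - q ^ (i%:Z - d%:Z - 1))
                * (1 - r * q ^ (i%:Z - d%:Z - 1))).

Definition affine_qKrawtchouk_normal q r : scalar_array K :=
  ScalarArray
    (fun i => q ^- i)
    (fun i => q ^- i)
    (fun i => q ^ (1 - 2 * i%:Z) * (1 - q ^+ i) * (1 - q ^ (i%:Z - d%:Z - 1))
                * (1 - r * q ^+ i))
    (fun i => - (r * q ^ (1 - i%:Z)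
                   * (1 - q ^+ i) * (1 - q ^ (i%:Z - d%:Z - 1)))).

Definition normalized_to p (N : scalar_array K) : Prop :=
  [/\ PA1 d N, PA2 d N & agree d p N].

Definition in_normal_form (f : q_family) p : Prop :=
  match f with
  | qRacah =>
      exists q s ss r,
        0 \notin [:: q; s; ss; r] /\ normalized_to p (qRacah_normal q s ss r)
  | qHahn =>
      exists q ss r,
        0 \notin [:: q; ss; r] /\ normalized_to p (qHahn_normal q ss r)
  | dual_qHahn =>
      exists q s r,
        0 \notin [:: q; s; r] /\ normalized_to p (dual_qHahn_normal q s r)
  | qKrawtchouk =>
      exists q ss,
        0 \notin [:: q; ss] /\ normalized_to p (qKrawtchouk_normal q ss)
  | dual_qKrawtchouk =>
      exists q s,
        0 \notin [:: q; s] /\ normalized_to p (dual_qKrawtchouk_normal q s)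
  | quantum_qKrawtchouk =>
      exists q r,
        0 \notin [:: q; r] /\ normalized_to p (quantum_qKrawtchouk_normal q r)
  | affine_qKrawtchouk =>
      exists q r,
        0 \notin [:: q; r] /\ normalized_to p (affine_qKrawtchouk_normal q r)
  end.

End Families.

(* Main.v *)
Require Import Defs.
From HB Require Import structures.
From mathcomp Require Import all_boot all_order all_algebra.
From mathcomp Require Import ring.

Set Implicit Arguments.
Unset Strict Implicit.
Unset Printing Implicit Defensive.

Import GRing.Theory.
Local Open Scope ring_scope.

(** Since (1 - q^i)(1 - s q^(i+1)) q^-i = q^-i + s q^(i+1) - (1 + s q), dividing
    by h and translating by a constant gives the normal form of theta, and
    likewise for theta-star.  For q-Racah take r = r1 and eliminate
    r2 = s s* q^(d+1) / r1; for quantum q-Krawtchouk s plays the role of h and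
    the new r is r / s.  The distinctness and nonvanishing conditions are
    invariant under affine transformations. *)

Lemma agree_trans (K : Type) (d : nat) (p1 p2 p3 : scalar_array K) :
  agree d p1 p2 -> agree d p2 p3 -> agree d p1 p3.
Proof.
move=> [th12 ph12] [th23 ph23]; split=> i le_id.
  by have [-> ->] := th12 i le_id; apply: th23.
by have [-> ->] := ph12 i le_id; apply: ph23.
Qed.

Lemma agree_affine (K : fieldType) (d : nat) (t c ts cs : K)
    (p1 p2 : scalar_array K) :
  agree d p1 p2 ->
  agree d (affine_transform t c ts cs p1) (affine_transform t c ts cs p2).
Proof.
move=> [th12 ph12]; split=> i le_id /=.
  by have [-> ->] := th12 i le_id.
by have [-> ->] := ph12 i le_id.
Qed.

Lemma PA1_agree (K : fieldType) (d : nat) (p1 p2 : scalar_array K) :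
  agree d p1 p2 -> PA1 d p1 -> PA1 d p2.
Proof.
move=> [th12 _] PA1p i j le_id le_jd neq_ij.
have [<- <-] := th12 i le_id; have [<- <-] := th12 j le_jd.
exact: PA1p.
Qed.

Lemma PA2_agree (K : fieldType) (d : nat) (p1 p2 : scalar_array K) :
  agree d p1 p2 -> PA2 d p1 -> PA2 d p2.
Proof.
by move=> [_ ph12] PA2p i le_id; have [<- <-] := ph12 i le_id; apply: PA2p.
Qed.

Lemma PA1_affine (K : fieldType) (d : nat) (t c ts cs : K)
    (p : scalar_array K) :
  t != 0 -> ts != 0 -> PA1 d p -> PA1 d (affine_transform t c ts cs p).
Proof.
move=> t0 ts0 PA1p i j le_id le_jd neq_ij /=.
by rewrite !(inj_eq (addIr _)) !(inj_eq (mulfI _)) //; apply: PA1p.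
Qed.

Lemma PA2_affine (K : fieldType) (d : nat) (t c ts cs : K)
    (p : scalar_array K) :
  t != 0 -> ts != 0 -> PA2 d p -> PA2 d (affine_transform t c ts cs p).
Proof.
move=> t0 ts0 PA2p i le_id /=; have [vphi0 phi0] := PA2p i le_id.
by rewrite !mulf_neq0.
Qed.

(** Common reduction for all families: [PA1] and [PA2] for [N] are transported from [p], so no
    inequality is ever read off the explicit formulas. What remains is that the affine map carries
    the family array [A] to [N]. *)
Lemma affine_normalized (K : fieldType) (d : nat) (h c hs cs : K)
    (p A N : scalar_array K) :
  parameter_array d p -> agree d p A -> h != 0 -> hs != 0 ->
  agree d (affine_transform h^-1 c hs^-1 cs A) N ->
  normalized_to d (affine_transform h^-1 c hs^-1 cs p) N.
Proof.
(* The scale factors are the inverses, so the nonvanishing hypotheses are restated for [h^-1] and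
   [hs^-1]. *)
rewrite -(invr_eq0 h) -(invr_eq0 hs).
move=> [PA1p PA2p _ _ _] pA h0 hs0 AN.
have pN := agree_trans (agree_affine h^-1 c hs^-1 cs pA) AN.
split=> //; first exact: PA1_agree pN (PA1_affine _ _ h0 hs0 PA1p).
exact: PA2_agree pN (PA2_affine _ _ h0 hs0 PA2p).
Qed.

Section NormalForms.

Variables (K : fieldType) (d : nat).

(** The translations are forced by i = 0: theta_0 must go to 1 + s q, and theta-star_0 to 1 + s*
    q. *)
Lemma qRacah_affine (th0 ths0 h hs q s ss r1 r2 : K) :
  h != 0 -> hs != 0 -> q != 0 -> ss != 0 -> r1 != 0 ->
  r1 * r2 = s * ss * q ^+ (d + 1) ->
  agree d (affine_transform h^-1 (1 + s * q - th0 / h)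
             hs^-1 (1 + ss * q - ths0 / hs)
             (qRacah_array d th0 ths0 h hs q s ss r1 r2))
    (qRacah_normal d q s ss r1).
Proof.
move=> h0 hs0 q0 ss0 r10 r12.
have -> : r2 = s * ss * q ^+ (d + 1) / r1 by rewrite -r12 mulrAC mulfV ?mul1r.
split=> i _ /=; have qi0 := expf_neq0 i q0; rewrite /Pfac ?exprD ?expr1.
  (* With x = q^i nonzero, q^-i is the inverse of x and q^(i+1) is x q, so both claims are rational
     identities in x. *)
  by move: (q ^+ i) qi0 => x x0; split; field; do ?[apply/andP; split].
(* The integer powers of q occur identically on both sides, so they can be treated as independent
   indeterminates; no relation between them is used. *)
move: (q ^+ i) (q ^+ d) (q ^ (_ - 1)) (q ^ (1 - _)) => x y z w.
by split; field; do ?[apply/andP; split].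
Qed.

Lemma qHahn_affine (th0 ths0 h hs q ss r : K) :
  h != 0 -> hs != 0 -> q != 0 ->
  agree d (affine_transform h^-1 (1 - th0 / h) hs^-1 (1 + ss * q - ths0 / hs)
             (qHahn_array d th0 ths0 h hs q ss r))
    (qHahn_normal d q ss r).
Proof.
move=> h0 hs0 q0.
split=> i _ /=; have qi0 := expf_neq0 i q0; rewrite /Pfac ?exprD ?expr1.
  by move: (q ^+ i) qi0 => x x0; split; field; do ?[apply/andP; split].
(* Abstraction runs from right to left: q^(1-2i) is gone before the looser pattern [q ^ (1 - _)] is
   matched, which therefore selects q^(1-i). *)
move: (q ^+ i) (q ^ (_ - 1)) (q ^ (1 - _)) (q ^ (1 - 2 * _)) => x z w v.
by split; field; do ?[apply/andP; split].
Qed.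

Lemma dual_qHahn_affine (th0 ths0 h hs q s r : K) :
  h != 0 -> hs != 0 -> q != 0 ->
  agree d (affine_transform h^-1 (1 + s * q - th0 / h) hs^-1 (1 - ths0 / hs)
             (dual_qHahn_array d th0 ths0 h hs q s r))
    (dual_qHahn_normal d q s r).
Proof.
move=> h0 hs0 q0.
split=> i _ /=; have qi0 := expf_neq0 i q0; rewrite /Pfac ?exprD ?expr1.
  by move: (q ^+ i) qi0 => x x0; split; field; do ?[apply/andP; split].
move: (q ^+ i) (q ^ (_ - 1)) (q ^ (1 - _)) (q ^ (d%:Z + _ - _)) => x z w v.
by split; field; do ?[apply/andP; split].
Qed.

(** Formally the case r = 0 of q-Hahn, where q^(1-i) q^i collapses to q in phi; hence the same
    scaling and translations. *)
Lemma qKrawtchouk_affine (th0 ths0 h hs q ss : K) :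
  h != 0 -> hs != 0 -> q != 0 ->
  agree d (affine_transform h^-1 (1 - th0 / h) hs^-1 (1 + ss * q - ths0 / hs)
             (qKrawtchouk_array d th0 ths0 h hs q ss))
    (qKrawtchouk_normal d q ss).
Proof.
move=> h0 hs0 q0.
split=> i _ /=; have qi0 := expf_neq0 i q0; rewrite /Pfac ?exprD ?expr1.
  by move: (q ^+ i) qi0 => x x0; split; field; do ?[apply/andP; split].
move: (q ^+ i) (q ^ (_ - 1)) (q ^ (1 - _)) => x z w.
by split; field; do ?[apply/andP; split].
Qed.

(** Formally the case r = 0 of dual q-Hahn. *)
Lemma dual_qKrawtchouk_affine (th0 ths0 h hs q s : K) :
  h != 0 -> hs != 0 -> q != 0 ->
  agree d (affine_transform h^-1 (1 + s * q - th0 / h) hs^-1 (1 - ths0 / hs)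
             (dual_qKrawtchouk_array d th0 ths0 h hs q s))
    (dual_qKrawtchouk_normal d q s).
Proof.
move=> h0 hs0 q0.
split=> i _ /=; have qi0 := expf_neq0 i q0; rewrite /Pfac ?exprD ?expr1.
  by move: (q ^+ i) qi0 => x x0; split; field; do ?[apply/andP; split].
move: (q ^+ i) (q ^ (_ - 1)) (q ^ (1 - _)) (q ^ (d%:Z + _ - _)) => x z w v.
by split; field; do ?[apply/andP; split].
Qed.

(** Here theta_i = (th0 - s q) + s q^(i+1), with no q^-i term: division by s leaves q^(i+1), whose
    value q at i = 0 gives the translation. The same division turns the factor s - r q^(i-d-1) of
    phi into 1 - (r/s) q^(i-d-1). *)
Lemma quantum_qKrawtchouk_affine (th0 ths0 hs q s r : K) :
  hs != 0 -> q != 0 -> s != 0 ->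
  agree d (affine_transform s^-1 (q - th0 / s) hs^-1 (1 - ths0 / hs)
             (quantum_qKrawtchouk_array d th0 ths0 hs q s r))
    (quantum_qKrawtchouk_normal d q (r / s)).
Proof.
move=> hs0 q0 s0.
split=> i _ /=; have qi0 := expf_neq0 i q0; rewrite /Pfac ?exprD ?expr1.
  by move: (q ^+ i) qi0 => x x0; split; field; do ?[apply/andP; split].
move: (q ^+ i) (q ^ (_ - 1)) (q ^ (1 - _)) (q ^ (d%:Z + _ - _)) => x z w v.
by split; field; do ?[apply/andP; split].
Qed.

(** Formally the case s* = 0 of q-Hahn. *)
Lemma affine_qKrawtchouk_affine (th0 ths0 h hs q r : K) :
  h != 0 -> hs != 0 -> q != 0 ->
  agree d (affine_transform h^-1 (1 - th0 / h) hs^-1 (1 - ths0 / hs)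
             (affine_qKrawtchouk_array d th0 ths0 h hs q r))
    (affine_qKrawtchouk_normal d q r).
Proof.
move=> h0 hs0 q0.
split=> i _ /=; have qi0 := expf_neq0 i q0; rewrite /Pfac ?exprD ?expr1.
  by move: (q ^+ i) qi0 => x x0; split; field; do ?[apply/andP; split].
move: (q ^+ i) (q ^ (_ - 1)) (q ^ (1 - _)) (q ^ (1 - 2 * _)) => x z w v.
by split; field; do ?[apply/andP; split].
Qed.

End NormalForms.

Theorem lemma5p1 (K : closedFieldType) (charK : 2%N \notin [pchar K]) (d : nat)
    (f : q_family) (p : scalar_array K) :
  parameter_array d p -> in_q_family d f p ->
  exists t c ts cs : K,
    [/\ t != 0, ts != 0 & in_normal_form d f (affine_transform t c ts cs p)].
Proof.
move=> PAp; case: f => /=.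
- move=> [th0 [ths0 [h [hs [q [s [ss [r1 [r2 []]]]]]]]]].
  rewrite !inE !negb_or !(eq_sym 0).
  move=> /and5P[h0 hs0 q0 s0 /and3P[ss0 r10 _]] r12 pA.
  (* The two translations stay open here, and in each later case; unification with the lemma of the
     family fixes them at the end. *)
  eexists h^-1, _, hs^-1, _; split; rewrite ?invr_neq0 //.
  exists q, s, ss, r1.
  split; first by rewrite !inE !negb_or !(eq_sym 0) q0 s0 ss0 r10.
  apply: (affine_normalized PAp pA h0 hs0).
  exact: qRacah_affine.
- move=> [th0 [ths0 [h [hs [q [ss [r []]]]]]]].
  rewrite !inE !negb_or !(eq_sym 0).
  move=> /and5P[h0 hs0 q0 ss0 r0] pA.
  eexists h^-1, _, hs^-1, _; split; rewrite ?invr_neq0 //.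
  exists q, ss, r; split; first by rewrite !inE !negb_or !(eq_sym 0) q0 ss0 r0.
  apply: (affine_normalized PAp pA h0 hs0).
  exact: qHahn_affine.
- move=> [th0 [ths0 [h [hs [q [s [r []]]]]]]].
  rewrite !inE !negb_or !(eq_sym 0).
  move=> /and5P[h0 hs0 q0 s0 r0] pA.
  eexists h^-1, _, hs^-1, _; split; rewrite ?invr_neq0 //.
  exists q, s, r; split; first by rewrite !inE !negb_or !(eq_sym 0) q0 s0 r0.
  apply: (affine_normalized PAp pA h0 hs0).
  exact: dual_qHahn_affine.
- move=> [th0 [ths0 [h [hs [q [ss []]]]]]].
  rewrite !inE !negb_or !(eq_sym 0).
  move=> /and4P[h0 hs0 q0 ss0] pA.
  eexists h^-1, _, hs^-1, _; split; rewrite ?invr_neq0 //.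
  exists q, ss; split; first by rewrite !inE !negb_or !(eq_sym 0) q0 ss0.
  apply: (affine_normalized PAp pA h0 hs0).
  exact: qKrawtchouk_affine.
- move=> [th0 [ths0 [h [hs [q [s []]]]]]].
  rewrite !inE !negb_or !(eq_sym 0).
  move=> /and4P[h0 hs0 q0 s0] pA.
  eexists h^-1, _, hs^-1, _; split; rewrite ?invr_neq0 //.
  exists q, s; split; first by rewrite !inE !negb_or !(eq_sym 0) q0 s0.
  apply: (affine_normalized PAp pA h0 hs0).
  exact: dual_qKrawtchouk_affine.
- move=> [th0 [ths0 [hs [q [s [r []]]]]]].
  rewrite !inE !negb_or !(eq_sym 0).
  move=> /and4P[hs0 q0 s0 r0] pA.
  eexists s^-1, _, hs^-1, _; split; rewrite ?invr_neq0 //.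
  exists q, (r / s); split.
    by rewrite !inE !negb_or !(eq_sym 0) q0 mulf_neq0 ?invr_neq0.
  apply: (affine_normalized PAp pA s0 hs0).
  exact: quantum_qKrawtchouk_affine.
- move=> [th0 [ths0 [h [hs [q [r []]]]]]].
  rewrite !inE !negb_or !(eq_sym 0).
  move=> /and4P[h0 hs0 q0 r0] pA.
  eexists h^-1, _, hs^-1, _; split; rewrite ?invr_neq0 //.
  exists q, r; split; first by rewrite !inE !negb_or !(eq_sym 0) q0 r0.
  apply: (affine_normalized PAp pA h0 hs0).
  exact: affine_qKrawtchouk_affine.
Qed.
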